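(* Let $U$ be an ultrafilter on a countable set $X$. The following are equivalent: (1) $U\cdot U\equiv_T U$; (2) $\prod_{n<\omega}U\equiv_T U$; (3) there is an ideal $I\subseteq U^*$ on $X$ such that $U$ has the $I$-pseudo intersection property and $\prod_{n<\omega}I\le_T U$.
   Context: $U^*=P(X)\setminus U$ is the dual ideal. For an ideal $I\subseteq U^*$ on $X$, $U$ has the $I$-pseudo intersection property ($I$-p.i.p.) if for every sequence $\langle A_n:n<\omega\rangle$ of elements of $U$ there is $A\in U$ with $A\setminus A_n\in I$ for every $n$. For filters $U$ on $X$, $V$ on $Y$, $U\cdot V$ is the filter on $X\times Y$ with $A\in U\cdot V$ iff $\{x:\{y:(x,y)\in A\}\in V\}\in U$. Ultrafilters are ordered by $\supseteq$, ideals by $\subseteq$, and countable products $\prod_{n<\omega}P$ carry the coordinatewise order. For posets $P,Q$, $P\le_T Q$ means there is $f:Q\to P$ sending cofinal subsets of $Q$ to cofinal subsets of $P$; $P\equiv_T Q$ means $P\le_TQ$ and $Q\le_TP$. *)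

(* Defs.v *)
From HB Require Import structures.
From mathcomp Require Import all_boot all_order.
From mathcomp Require Export all_classical.
Export SetOrder.Exports FunOrder.Exports.

Set Implicit Arguments.
Unset Strict Implicit.
Unset Printing Implicit Defensive.

Import Order.TTheory.
Local Open Scope classical_set_scope.

(* A set system, seen as a type, is ordered by inclusion of its members.
   Hence [U^d] is [U] ordered by reverse inclusion, and by FunOrder
   [nat -> P] is the countable power of [P] with the coordinatewise order. *)
HB.instance Definition _ (X : Type) (U : set_system X) :=
  SubChoice.copy (set_type U) {A : set X | A \in U}.
HB.instance Definition _ (X : Type) (U : set_system X) :=
  [SubChoice_isSubPOrder of set_type U by <: with set_display].

Definition cofinal (d : Order.disp_t) (P : porderType d) (C : set P) :=
  forall p : P, exists2 c, C c & (p <= c)%O.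

Definition tukey_le (d d' : Order.disp_t) (P : porderType d)
    (Q : porderType d') :=
  exists f : Q -> P, forall C : set Q, cofinal C -> cofinal (f @` C).

Definition tukey_eq (d d' : Order.disp_t) (P : porderType d)
    (Q : porderType d') :=
  tukey_le P Q /\ tukey_le Q P.

Definition fubini (X Y : Type) (U : set_system X) (V : set_system Y) :
    set_system (X * Y) :=
  [set A | U [set x | V [set y | A (x, y)]]].

Definition dual_ideal (X : Type) (U : set_system X) : set_system X := ~` U.

(* Ideals need be neither proper nor contain the finite sets. *)
Definition is_ideal (X : Type) (I : set_system X) :=
  [/\ I set0,
      forall A B, A `<=` B -> I B -> I A &
      forall A B, I A -> I B -> I (A `|` B)].

Definition pseudo_intersection_property (X : Type) (I U : set_system X) :=
  forall A_ : nat -> set X, (forall n, U (A_ n)) ->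
  exists2 A, U A & forall n, I (A `\` A_ n).

Lemma le_systemE (X : Type) (U : set_system X) (A B : U) :
  (A <= B)%O = `[< val A `<=` val B >].
Proof. by []. Qed.

Lemma le_dual_systemE (X : Type) (U : set_system X) (A B : U^d) :
  (A <= B)%O = `[< val (B : U) `<=` val (A : U) >].
Proof. by []. Qed.

Lemma le_powerE (d : Order.disp_t) (P : porderType d) (f g : nat -> P) :
  (f <= g)%O = `[< forall n, (f n <= g n)%O >].
Proof. by []. Qed.

Lemma fubini_ultrafilter (X Y : Type) (U : set_system X) (V : set_system Y) :
  UltraFilter U -> UltraFilter V -> UltraFilter (fubini U V).
Proof.
move=> UU UV.
have FF : Filter (fubini U V).
  split.
  - apply: (@filterS _ U _ setT); last exact: filterT.
    by move=> x _; exact: filterT.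
  - move=> A B UA UB.
    apply: (@filterS _ U _ _ _ _ (@filterI _ U _ _ _ UA UB)) => x [VA VB].
    exact: filterI.
  - move=> A B AB; apply: (@filterS _ U) => x; apply: filterS => y; exact: AB.
have FP : ProperFilter (fubini U V).
  apply: Build_ProperFilter_ex => A UA.
  have [x VA] := @filter_ex _ U _ _ UA; have [y Axy] := filter_ex VA.
  by exists (x, y).
split=> // G GP sub; apply/seteqP; split=> // A GA.
have [//|UN] := in_ultra_setVsetC [set x | V [set y | A (x, y)]] UU.
have : fubini U V (~` A).
  apply: (@filterS _ U _ _ _ _ UN) => x /= nVA.
  by have [//|] := in_ultra_setVsetC [set y | A (x, y)] UV.
by move=> /sub GnA; have [p [Ap nAp]] := filter_ex (filterI GA GnA).
Qed.

(* Main.v *)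
Require Import Defs.
From mathcomp Require Import all_boot all_order all_classical.
Local Open Scope classical_set_scope.

(** A cofinal map [f : Q -> P] is one for which every [p] has a threshold [q]
    beyond which [f] stays above [p].

    For an ultrafilter [U] on a countable set, [U . U] is always Tukey
    equivalent to [U^nat].  A set in [U . U] is coded by its base together with
    its fibres, indexed through an injection [c : X -> nat]; conversely a
    sequence [A_] is coded by the set of the [(x, y)] with [y] in [A_ i] for all
    [i <= c x], from which [A_ n] is recovered as a fibre over some [x] with
    [n <= c x].  Such an [x] exists unless [U] is principal, in which case both
    orders have a greatest element.

    If [U^nat] is below [U], the dual ideal itself witnesses (3).  Conversely,
    given [I] and a sequence [A_] with pseudo-intersection [A], the pair formed
    by [A] and the errors [A `\` A_ n] in [I] determines sets [A `\` E n] of [U]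
    refining the [A_ n], so [U^nat] is below [U * I^nat], hence below [U]. *)

Lemma tukey_leP (d d' : Order.disp_t) (P : porderType d) (Q : porderType d') :
  tukey_le P Q <->
  exists f : Q -> P, forall p, exists q, forall q', (q <= q')%O -> (p <= f q')%O.
Proof.
split=> -[f fP]; exists f.
  move=> p; apply: contrapT => /forallNP nq.
  (* Without a threshold for [p], the [q] with [f q] not above [p] form a cofinal set, whose image
     has nothing above [p]. *)
  have /fP /(_ p) [_ [q npq <-] pq] : cofinal [set q | ~ (p <= f q)%O].
    move=> q; have /existsNP[q' /not_implyP[qq' npq']] := nq q.
    by exists q'.
  exact: npq.
move=> C Ccof p; have [q qP] := fP p; have [c Cc qc] := Ccof q.
by exists (f c); [exists c|exact: qP].
Qed.

Lemma tukey_le_trans (d1 d2 d3 : Order.disp_t) (P : porderType d1)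
    (Q : porderType d2) (R : porderType d3) :
  tukey_le P Q -> tukey_le Q R -> tukey_le P R.
Proof.
move=> [f fP] [g gP]; exists (f \o g) => C /gP /fP.
by rewrite -image_comp.
Qed.

Lemma tukey_eq_congl (d1 d2 d3 : Order.disp_t) (P : porderType d1)
    (Q : porderType d2) (R : porderType d3) :
  tukey_eq P Q -> tukey_eq P R -> tukey_eq Q R.
Proof.
by move=> [PQ QP] [PR RP]; split; [exact: tukey_le_trans QP PR|
  exact: tukey_le_trans RP PQ].
Qed.

Lemma tukey_eq_sym (d1 d2 : Order.disp_t) (P : porderType d1)
    (Q : porderType d2) : tukey_eq P Q -> tukey_eq Q P.
Proof. by case. Qed.

Lemma tukey_le_top (d d' : Order.disp_t) (P : porderType d)
    (Q : porderType d') (t : P) (q : Q) :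
  (forall p, (p <= t)%O) -> tukey_le P Q.
Proof. by move=> tP; apply/tukey_leP; exists (fun=> t) => p; exists q. Qed.

Definition member {X : Type} {S : set_system X} {A : set X} (SA : S A) : S :=
  exist _ A (mem_set SA).

Section Ultrafilter.
Context {X : Type} {U : set_system X}.
Hypothesis hU : UltraFilter U.

Let UC (A : set X) : ~ U A -> U (~` A).
Proof. by have [] := in_ultra_setVsetC A hU. Qed.

Lemma ultra_setU (A B : set X) : U (A `|` B) -> U A \/ U B.
Proof.
move=> UAB; have [|UnA] := in_ultra_setVsetC A hU; first by left.
by right; apply: filterS (filterI UAB UnA) => x [[]].
Qed.

Lemma dual_ideal_ideal : is_ideal (dual_ideal U).
Proof.
split=> [U0|A B AB nUB UA|A B nUA nUB /ultra_setU[]//].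
- by have [] := filter_ex U0.
- by apply: nUB; exact: filterS UA.
Qed.

(** Induction on [n]: [U] contains either the shorter initial segment or the level [c x = n], a
    singleton by injectivity. *)
Lemma ultra_initial_principal (c : X -> nat) : injective c ->
  forall n, U [set x | c x < n]%N -> exists x, U [set x].
Proof.
move=> cI; elim=> [U0|n IH Un]; first by have [] := filter_ex U0.
have /ultra_setU[/IH//|Ucn] : U ([set x | c x < n]%N `|` [set x | c x = n]).
  apply: filterS Un => x /=.
  rewrite ltnS leq_eqVlt => /orP[/eqP|].
    by right.
  by left.
have [x cx] := filter_ex Ucn; exists x; apply: filterS Ucn => y /= cy.
by apply: cI; rewrite cx cy.
Qed.

Lemma tukey_le_fubini_power : countable [set: X] ->
  tukey_le ((fubini U U)^d)%type (nat -> U^d)%type.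
Proof.
move=> /countable_injP[c /in2TT cI]; apply/tukey_leP.
(* Index 0 is reserved for the base, which shifts the fibre over [x] to index [(c x).+1]. *)
have fP (B : nat -> U^d) : fubini U U
    [set z | val (B 0 : U) z.1 /\ val (B (c z.1).+1 : U) z.2].
  apply: filterS (set_valP (B 0 : U)) => x B0x /=.
  by apply: filterS (set_valP (B (c x).+1 : U)) => y.
exists (fun B => member (fP B)) => A.
pose fib x := [set y | val (A : fubini U U) (x, y)].
have /choice[B BP] (n : nat) : exists b : U^d,
    (n = 0 -> val (b : U) `<=` [set x | U (fib x)]) /\
    forall x, n = (c x).+1 -> U (fib x) -> val (b : U) `<=` fib x.
  case: n => [|n].
    have UA : U [set x | U (fib x)] := set_valP (A : fubini U U).
    by exists (member UA); split=> [_ x|].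
  have [[x [-> Ux]]|nx] := pselect (exists x, n = c x /\ U (fib x)).
    by exists (member Ux); split=> // x' [/cI <-] _ y.
  (* An index that codes no point of the base imposes no constraint. *)
  exists (member (@filterT _ U _)); split=> // x [nc] Ux.
  by case: nx; exists x.
exists B => B' /asboolP BB'; apply/asboolP => -[x y] /= [B'x B'y].
have sub n : val (B' n : U) `<=` val (B n : U) by exact/asboolP/BB'.
have Ux : U (fib x) by apply: (proj1 (BP 0)) => //; exact: sub.
by apply: (proj2 (BP (c x).+1) x) => //; exact: sub.
Qed.

Lemma tukey_le_power_fubini : countable [set: X] ->
  tukey_le (nat -> U^d)%type ((fubini U U)^d)%type.
Proof.
move=> /countable_injP[c /in2TT cI].
have [[x Ux]|nprinc] := pselect (exists x, U [set x]).
  have UT : fubini U U setT.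
    by apply: filterS (filterT (F := U)) => y _; exact: filterT.
  (* Every member of [U] contains [x], so [[set x]] is greatest in [U^d]. *)
  apply: (tukey_le_top _ _ (nat -> U^d)%type ((fubini U U)^d)%type
    (fun=> member Ux) (member UT)) => A.
  apply/asboolP => n; apply/asboolP => _ ->.
  by have [_ [/= ->]] := filter_ex (filterI Ux (set_valP (A n : U))).
apply/tukey_leP.
have tail n : U [set x | n <= c x]%N.
  have [//|Un] := in_ultra_setVsetC [set x | n <= c x]%N hU.
  case: nprinc; apply: (@ultra_initial_principal c cI n).
  by apply: filterS Un => x /= /negP; rewrite -ltnNge.
have /choice[f fP] (B : (fubini U U)^d) : exists b : nat -> U^d, forall n,
    exists2 x, (n <= c x)%N &
    val (b n : U) = [set y | val (B : fubini U U) (x, y)].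
  have /choice[b bP] (n : nat) : exists b : U^d, exists2 x, (n <= c x)%N &
      val (b : U) = [set y | val (B : fubini U U) (x, y)].
    have [x [nx Bx]] := filter_ex (filterI (tail n) (set_valP (B : fubini U U))).
    by exists (member Bx); exists x.
  by exists b.
exists f => A.
have UA (m : nat) : U [set y | forall i, (i <= m)%N -> val (A i : U) y].
  elim: m => [|m IH].
    by apply: filterS (set_valP (A 0 : U)) => y A0 i; rewrite leqn0 => /eqP ->.
  apply: filterS (filterI IH (set_valP (A m.+1 : U))) => y [Am AS] i.
  by rewrite leq_eqVlt => /orP[/eqP -> //|]; exact: Am.
(* Over any [x] with [n <= c x] the fibre of this set lies in [A n], so it does not matter which
   such [x] was chosen for [B] and [n]. *)
have UUA : fubini U U [set z | forall i, (i <= c z.1)%N -> val (A i : U) z.2].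
  by apply: filterS (filterT (F := U)) => x _; exact: (UA (c x)).
exists (member UUA) => B /asboolP BA; apply/asboolP => n; apply/asboolP => y.
by have [x nx ->] := fP B n => /BA; apply.
Qed.

Lemma tukey_eq_fubini_power : countable [set: X] ->
  tukey_eq ((fubini U U)^d)%type (nat -> U^d)%type.
Proof.
by move=> cX; split; [exact: tukey_le_fubini_power|exact: tukey_le_power_fubini].
Qed.

(** The whole space serves as [A], since complements of members of [U] are outside [U]. *)
Lemma pseudo_intersection_dual_ideal :
  pseudo_intersection_property (dual_ideal U) U.
Proof.
move=> A_ UA; exists setT => [|n UN]; first exact: filterT.
by have [x [? [_]]] := filter_ex (filterI (UA n) UN).
Qed.

(** Complementation in each coordinate is an order isomorphism. *)
Lemma tukey_le_power_dual_ideal :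
  tukey_le (nat -> dual_ideal U)%type (nat -> U^d)%type.
Proof.
apply/tukey_leP.
have fP (B : U) : dual_ideal U (~` val B).
  by move=> UnB; have [x []] := filter_ex (filterI (set_valP B) UnB).
exists (fun B n => member (fP (B n))) => J.
exists (fun n => member (UC _ (set_valP (J n)))) => B /asboolP JB.
apply/asboolP => n; apply/asboolP => x Jx Bx.
by have /asboolP /(_ x Bx) := JB n.
Qed.

Lemma tukey_le_power_pip (I : set_system X) : I `<=` dual_ideal U ->
  pseudo_intersection_property I U -> tukey_le (nat -> I)%type (U^d)%type ->
  tukey_le (nat -> U^d)%type (U^d)%type.
Proof.
move=> IU pip /tukey_leP[f fP]; apply/tukey_leP.
have UD (B : U) (J : I) : U (val B `\` val J).
  by apply: filterI (set_valP B) _; apply: UC; exact: IU (set_valP J).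
(* A single [B] stands for both components of the pair: itself for the pseudo-intersection, and
   [f B] for the errors. *)
exists (fun B n => member (UD B (f B n))) => A_.
have [A UA IA] := pip (fun n => val (A_ n : U)) (fun n => set_valP (A_ n : U)).
have [C CP] := fP (fun n => member (IA n)).
(* Inside [A], [B] can leave [A_ n] only within the error [A_ n] makes; inside [C], that error is
   covered by [f B n]. *)
exists (member (filterI UA (set_valP (C : U)))) => B /asboolP BAC.
have /CP /asboolP IB : (C <= B)%O by apply/asboolP => x /BAC[].
apply/asboolP => n; apply/asboolP => x [Bx nfx].
apply: contrapT => nAx; apply: nfx.
by have /asboolP := IB n; apply; split=> //; have [] := BAC x Bx.
Qed.

Lemma tukey_le_power : tukey_le (U^d)%type (nat -> U^d)%type.
Proof.
apply/tukey_leP; exists (fun B => B 0) => A; exists (fun=> A) => B /asboolP.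
exact.
Qed.

End Ultrafilter.

Theorem theorem1p17 (X : Type) (U : set_system X)
    (hX : countable [set: X]) (hU : UltraFilter U) :
  [<-> tukey_eq ((fubini U U)^d)%type (U^d)%type;
       tukey_eq (nat -> U^d)%type (U^d)%type;
       exists I : set_system X,
         [/\ is_ideal I,
             I `<=` dual_ideal U,
             pseudo_intersection_property I U &
             tukey_le (nat -> I)%type (U^d)%type]].
Proof.
have FP := tukey_eq_fubini_power hU hX.
tfae.
- exact: tukey_eq_congl FP.
- move=> [PU _]; exists (dual_ideal U); split=> //.
  + exact: dual_ideal_ideal.
  + exact: pseudo_intersection_dual_ideal.
  + exact: tukey_le_trans (tukey_le_power_dual_ideal hU) PU.
- move=> [I [_ IU pip IT]].
  apply: (tukey_eq_congl _ _ _ _ _ _ (tukey_eq_sym _ _ _ _ FP)).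
  by split; [exact: tukey_le_power_pip IT|exact: tukey_le_power].
Qed.
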